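(* Let $g\ge 1$ be an integer, let $h\in\mathbb{R}$ be such that $\hbar=\frac{h}{2\pi}$ is irrational, and let $\sigma:\mathbb{Z}^{2g}\times\mathbb{Z}^{2g}\to\mathbb{Z}$ be any skew-symmetric, non-degenerate bilinear form. Then the only $\mathrm{Sp}(\mathbb{Z}^{2g},\sigma)$-invariant state on the algebraic noncommutative torus $\mathcal{A}^h_{g,\sigma}$ is the trace state $\tau$, i.e. the linear functional determined by $$\tau(W_m)=\begin{cases}1 & \text{if } m=0,\\ 0 & \text{if } m\in\mathbb{Z}^{2g}\setminus\{0\}.\end{cases}$$
   Context: Non-degenerate means: if $\sigma(m,n)=0$ for all $n\in\mathbb{Z}^{2g}$ then $m=0$. The algebraic noncommutative torus $\mathcal{A}^h_{g,\sigma}$ (a twisted group $*$-algebra of $\mathbb{Z}^{2g}$) is the complex vector space with basis $\{W_m\}_{m\in\mathbb{Z}^{2g}}$, whose elements are finite linear combinations $\sum_m\alpha_m W_m$, equipped with the bilinear product determined by $W_nW_m=e^{i h\sigma(n,m)}W_{n+m}$ and the antilinear involution determined by $W_m^*=W_{-m}$. Its unit is $W_0$. $\mathrm{Sp}(\mathbb{Z}^{2g},\sigma)$ is the group of all group automorphisms $\Theta$ of $\mathbb{Z}^{2g}$ with $\sigma(\Theta m,\Theta n)=\sigma(m,n)$ for all $m,n$. It acts on $\mathcal{A}^h_{g,\sigma}$ by the $*$-automorphisms $\Phi_\Theta$ given by $\Phi_\Theta(W_m)=W_{\Theta m}$, extended linearly. A state is a linear functional $\omega:\mathcal{A}^h_{g,\sigma}\to\mathbb{C}$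 that is positive ($\omega(a^*a)\ge 0$ for all $a$) and normalized ($\omega(W_0)=1$). It is $\mathrm{Sp}(\mathbb{Z}^{2g},\sigma)$-invariant if $\omega\circ\Phi_\Theta=\omega$ for every $\Theta\in\mathrm{Sp}(\mathbb{Z}^{2g},\sigma)$. *)

(* Defs.v *)
From HB Require Import structures.
From mathcomp Require Import all_boot all_order all_algebra.
From mathcomp Require Import finmap monalg complex.
From mathcomp Require Import boolp classical_sets reals trigo.

Set Implicit Arguments.
Unset Strict Implicit.
Unset Printing Implicit Defensive.

Import Order.TTheory GRing.Theory Num.Theory.

Local Open Scope ring_scope.
Local Open Scope complex_scope.

Section Phase.
Context {R : realType}.

(* e^{it} for real t *)
Definition expi (t : R) : R[i] := cos t +i* sin t.

Lemma expi0 : expi 0 = 1.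
Proof. by rewrite /expi cos0 sin0. Qed.

Lemma expiD (s t : R) : expi (s + t) = expi s * expi t.
Proof. by rewrite /expi cosD sinD /GRing.mul /= [sin s * _ + _]addrC. Qed.

Lemma conjc_expi (t : R) : (expi t)^* = expi (- t).
Proof. by rewrite /expi cosN sinN. Qed.

End Phase.

Notation lattice n := 'rV[int]_n.

(* The finitely supported functions lattice n -> R[i], seen as the finite
   linear combinations of a basis W indexed by lattice n; h and sigma are
   parameters of the type because the product depends on them. *)
Definition nctorus (R : realType) (n : nat) (h : R)
  (sigma : {biscalar (lattice n)}) : Type := {malg (R[i])[lattice n]}.

(* The basis vectors and the operations below are locked because unification
   would otherwise unfold complex arithmetic under finite sums. *)
HB.lock Definition W (R : realType) (n : nat) (h : R)
    (sigma : {biscalar (lattice n)}) (m : lattice n) : nctorus h sigma :=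
  (<< m >> : {malg (R[i])[lattice n]}).

(* The vector space operations are those of {malg R[i][lattice n]}. *)
HB.lock Definition nct_zero (R : realType) (n : nat) (h : R)
    (sigma : {biscalar (lattice n)}) : nctorus h sigma :=
  (0 : {malg (R[i])[lattice n]}).

HB.lock Definition nct_opp (R : realType) (n : nat) (h : R)
    (sigma : {biscalar (lattice n)}) (a : nctorus h sigma) : nctorus h sigma :=
  - (a : {malg (R[i])[lattice n]}).

HB.lock Definition nct_add (R : realType) (n : nat) (h : R)
    (sigma : {biscalar (lattice n)}) (a b : nctorus h sigma) :
    nctorus h sigma :=
  (a : {malg (R[i])[lattice n]}) + (b : {malg (R[i])[lattice n]}).

HB.lock Definition nct_scale (R : realType) (n : nat) (h : R)
    (sigma : {biscalar (lattice n)}) (x : R[i]) (a : nctorus h sigma) :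
    nctorus h sigma :=
  x *: (a : {malg (R[i])[lattice n]}).

Arguments W {R n h sigma} m.
Arguments nct_zero {R n h sigma}.
Arguments nct_opp {R n h sigma} a.
Arguments nct_add {R n h sigma} a b.
Arguments nct_scale {R n h sigma} x a.

Section NCTorusLmodule.
Context {R : realType} {n : nat} {h : R} {sigma : {biscalar (lattice n)}}.

Local Notation A := (nctorus h sigma).
Local Notation M := {malg (R[i])[lattice n]}.
Implicit Types (a b c : A) (m : lattice n).

Definition coef m a : R[i] := (a : M)@_m.

Definition supp a : seq (lattice n) := msupp (a : M).

Fact nct_addA : associative (@nct_add R n h sigma).
Proof. by move=> a b c; rewrite !nct_add.unlock; apply: addrA. Qed.

Fact nct_addC : commutative (@nct_add R n h sigma).
Proof. by move=> a b; rewrite !nct_add.unlock; apply: addrC. Qed.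

Fact nct_add0 : left_id (@nct_zero R n h sigma) nct_add.
Proof. by move=> a; rewrite nct_add.unlock nct_zero.unlock; apply: add0r. Qed.

Fact nct_addN : left_inverse (@nct_zero R n h sigma) nct_opp nct_add.
Proof.
move=> a; rewrite nct_add.unlock nct_zero.unlock nct_opp.unlock.
exact: addNr.
Qed.

HB.instance Definition _ := Choice.copy A M.
HB.instance Definition _ :=
  GRing.isZmodule.Build A nct_addA nct_addC nct_add0 nct_addN.

Fact nct_scaleA x y a : nct_scale x (nct_scale y a) = nct_scale (x * y) a.
Proof. by rewrite !nct_scale.unlock; apply: scalerA. Qed.

Fact nct_scale1 : left_id 1 (@nct_scale R n h sigma).
Proof. by move=> a; rewrite nct_scale.unlock; apply: scale1r. Qed.

Fact nct_scaleDr : right_distributive (@nct_scale R n h sigma) +%R.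
Proof.
move=> x a b; rewrite /GRing.add /= !nct_scale.unlock nct_add.unlock.
exact: scalerDr.
Qed.

Fact nct_scaleDl a : {morph nct_scale^~ a : x y / x + y}.
Proof.
move=> x y /=; rewrite [RHS]/GRing.add /= !nct_scale.unlock nct_add.unlock.
exact: scalerDl.
Qed.

HB.instance Definition _ := GRing.Zmodule_isLmodule.Build R[i] A
  nct_scaleA nct_scale1 nct_scaleDr nct_scaleDl.

Lemma coefP a b : (forall m, coef m a = coef m b) <-> a = b.
Proof. exact: malgP. Qed.

Lemma coefD m a b : coef m (a + b) = coef m a + coef m b.
Proof.
rewrite /coef [a + b]/GRing.add /= nct_add.unlock.
exact: (@mcoeffD _ _ m (a : M) b).
Qed.

Lemma coefZ m x a : coef m (x *: a) = x * coef m a.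
Proof.
rewrite /coef [x *: a]/GRing.scale /= nct_scale.unlock.
exact: (@mcoeffZ _ _ x (a : M) m).
Qed.

Fact coef_scalar m : scalar (coef m).
Proof. by move=> x a b; rewrite coefD coefZ. Qed.

HB.instance Definition _ m :=
  GRing.isLinear.Build R[i] A R[i] *%R (coef m) (coef_scalar m).

Lemma coefW k m : coef k (W m : A) = (m == k)%:R.
Proof. by rewrite /coef W.unlock mcoeffU. Qed.

Lemma mem_supp m a : (m \in supp a) = (coef m a != 0).
Proof. by rewrite /supp -mcoeff_neq0. Qed.

Lemma supp_uniq a : uniq (supp a).
Proof. exact: fset_uniq. Qed.

Lemma suppW m : supp (W m : A) = [:: m].
Proof. by rewrite /supp W.unlock msuppU oner_eq0; exact: (esym (fset_seq1 m)). Qed.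

(* Sums weighted by the coefficients may range over any larger finite set. *)
Lemma supp_widen (V : lmodType R[i]) (g : R[i] -> R[i]) (f : lattice n -> V)
    (s : seq (lattice n)) a :
  g 0 = 0 -> uniq s -> {subset supp a <= s} ->
  \sum_(m <- supp a) g (coef m a) *: f m = \sum_(m <- s) g (coef m a) *: f m.
Proof.
move=> g0 us sub.
rewrite [RHS](bigID (mem (supp a))) /= [X in _ + X]big1 ?addr0 => [|m]; last first.
  by rewrite mem_supp negbK => /eqP ->; rewrite g0 scale0r.
rewrite -[RHS]big_filter; apply/perm_big/uniq_perm.
- exact: supp_uniq.
- exact: filter_uniq.
by move=> m; rewrite mem_filter /=; case: (boolP (m \in supp a)) => [/sub|].
Qed.

Lemma W_span a : a = \sum_(m <- supp a) coef m a *: W m.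
Proof.
apply/coefP => k; rewrite linear_sum /=.
under eq_bigr do rewrite linearZ /= coefW.
have [ka|ka] := boolP (k \in supp a).
  rewrite (bigD1_seq k) ?supp_uniq //= eqxx mulr1 big1 ?addr0 // => m /negPf ->.
  by rewrite mulr0.
rewrite big_seq big1 => [|m ma]; last first.
  by case: eqVneq ma ka => [->|_ _ _]; rewrite ?mulr0 // => ->.
by apply/eqP; rewrite -[_ == 0]negbK -mem_supp.
Qed.

Lemma nct_ind (P : A -> Prop) :
  P 0 -> (forall x a b, P a -> P b -> P (x *: a + b)) -> (forall m, P (W m)) ->
  forall a, P a.
Proof.
move=> P0 PD PW a; rewrite [a]W_span.
by apply: big_rec => // m b _ Pb; apply: PD.
Qed.

Section LinearExtension.
Context (V : lmodType R[i]).
Implicit Types (f : lattice n -> V).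

(* The linear map sending W m to f m *)
Definition linext f a : V := \sum_(m <- supp a) coef m a *: f m.

(* The antilinear map sending W m to f m *)
Definition antilinext f a : V := \sum_(m <- supp a) (coef m a)^* *: f m.

Fact linext_is_linear f : linear (linext f).
Proof.
move=> x a b; rewrite /linext.
pose s := undup (supp (x *: a + b) ++ supp a ++ supp b).
have wid c : {subset supp c <= s} ->
    \sum_(m <- supp c) coef m c *: f m = \sum_(m <- s) coef m c *: f m.
  by move=> cs; apply: (@supp_widen _ idfun); rewrite ?undup_uniq.
rewrite !wid => [|m|m|m]; try by rewrite mem_undup !mem_cat => ->; rewrite ?orbT.
rewrite scaler_sumr -big_split; apply: eq_bigr => m _ /=.
by rewrite coefD coefZ scalerDl scalerA.
Qed.

HB.instance Definition _ f :=
  GRing.isLinear.Build R[i] A V *:%R (linext f) (linext_is_linear f).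

Lemma linextW f m : linext f (W m : A) = f m.
Proof. by rewrite /linext suppW big_seq1 coefW eqxx scale1r. Qed.

Lemma antilinext_antilinear f x a b :
  antilinext f (x *: a + b) = x^* *: antilinext f a + antilinext f b.
Proof.
rewrite /antilinext.
pose s := undup (supp (x *: a + b) ++ supp a ++ supp b).
have wid c : {subset supp c <= s} ->
    \sum_(m <- supp c) (coef m c)^* *: f m
      = \sum_(m <- s) (coef m c)^* *: f m.
  by move=> cs; apply: (@supp_widen _ conjc); rewrite ?undup_uniq ?rmorph0.
rewrite !wid => [|m|m|m]; try by rewrite mem_undup !mem_cat => ->; rewrite ?orbT.
rewrite scaler_sumr -big_split; apply: eq_bigr => m _ /=.
by rewrite coefD coefZ rmorphD rmorphM scalerDl scalerA.
Qed.

Lemma antilinextW f m : antilinext f (W m : A) = f m.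
Proof. by rewrite /antilinext suppW big_seq1 coefW eqxx rmorph1 scale1r. Qed.

End LinearExtension.

End NCTorusLmodule.

Arguments nct_ind [R n h sigma] P.

(* The bilinear extension of W_k W_l = e^{ih sigma(k,l)} W_{k+l} *)
HB.lock Definition nct_mul (R : realType) (n : nat) (h : R)
    (sigma : {biscalar (lattice n)}) (a b : nctorus h sigma) :
    nctorus h sigma :=
  linext (fun k =>
    linext (fun l => expi (h * (sigma k l)%:~R) *: W (k + l)) b) a.

Arguments nct_mul {R n h sigma} a b.

Section NCTorusAlgebra.
Context {R : realType} {n : nat} {h : R} {sigma : {biscalar (lattice n)}}.

Local Notation A := (nctorus h sigma).
Implicit Types (a b c : A) (k l m : lattice n).

Lemma nct_mulE a b : nct_mul a b =
  linext (fun k => linext (fun l => expi (h * (sigma k l)%:~R) *: W (k + l)) b)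
    a.
Proof. by rewrite nct_mul.unlock. Qed.

Lemma nct_mulWW k l :
  nct_mul (W k) (W l) = expi (h * (sigma k l)%:~R) *: W (k + l) :> A.
Proof. by rewrite nct_mulE !linextW. Qed.

Lemma nct_mul_linearl b : linear (nct_mul ^~ b).
Proof. by move=> x a c; rewrite !nct_mulE linearP. Qed.

Lemma nct_mul_linearr a : linear (nct_mul a).
Proof.
move=> x b c; rewrite !nct_mulE {1 3 5}/linext scaler_sumr -big_split.
by apply: eq_bigr => m _ /=; rewrite linearP scalerDr !scalerA [x * _]mulrC.
Qed.

Lemma nct_mul0l b : nct_mul 0 b = 0.
Proof. by rewrite !nct_mulE linear0. Qed.

Lemma nct_mul0r a : nct_mul a 0 = 0.
Proof.
by have := nct_mul_linearr a (-1) 0 0; rewrite scaler0 addr0 scaleN1r addNr.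
Qed.

Lemma nct_mulDl : left_distributive (@nct_mul R n h sigma) +%R.
Proof.
by move=> a b c; have := nct_mul_linearl c 1 a b; rewrite /= !scale1r.
Qed.

Lemma nct_mulDr : right_distributive (@nct_mul R n h sigma) +%R.
Proof. by move=> a b c; have := nct_mul_linearr a 1 b c; rewrite !scale1r. Qed.

Lemma nct_mulZl x a b : x *: nct_mul a b = nct_mul (x *: a) b.
Proof. by rewrite !nct_mulE linearZ. Qed.

Lemma nct_mulZr x a b : x *: nct_mul a b = nct_mul a (x *: b).
Proof. by have := nct_mul_linearr a x b 0; rewrite nct_mul0r !addr0. Qed.

Lemma nct_mulA : associative (@nct_mul R n h sigma).
Proof.
move=> a b c; elim/nct_ind: a => [|x a a' IHa IHa'|k].
- by rewrite !nct_mul0l.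
- by rewrite !nct_mulDl -!nct_mulZl IHa IHa'.
elim/nct_ind: b => [|x b b' IHb IHb'|l].
- by rewrite !(nct_mul0l, nct_mul0r).
- by rewrite !(nct_mulDl, nct_mulDr) -!(nct_mulZl, nct_mulZr) IHb IHb'.
elim/nct_ind: c => [|x c c' IHc IHc'|m].
- by rewrite !nct_mul0r.
- by rewrite !nct_mulDr -!nct_mulZr IHc IHc'.
rewrite !nct_mulWW -nct_mulZr -nct_mulZl !nct_mulWW !scalerA -!expiD addrA.
by rewrite -!mulrDr -!intrD linearDr linearDl [_ + sigma l m]addrC addrCA
  [sigma l m + _]addrC !addrA.
Qed.

Lemma nct_mul1l : left_id (W 0 : A) nct_mul.
Proof.
move=> a; elim/nct_ind: a => [|x a b IHa IHb|m]; first exact: nct_mul0r.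
  by rewrite nct_mulDr -nct_mulZr IHa IHb.
by rewrite nct_mulWW linear0l mulr0 expi0 scale1r add0r.
Qed.

Lemma nct_mul1r : right_id (W 0 : A) nct_mul.
Proof.
move=> a; elim/nct_ind: a => [|x a b IHa IHb|m]; first exact: nct_mul0l.
  by rewrite nct_mulDl -nct_mulZl IHa IHb.
by rewrite nct_mulWW linear0r mulr0 expi0 scale1r addr0.
Qed.

Lemma nct_1neq0 : W 0 != 0 :> A.
Proof.
apply/eqP => /(congr1 (coef 0)); rewrite coefW eqxx linear0.
by apply/eqP; apply: oner_neq0.
Qed.

HB.instance Definition _ := GRing.Zmodule_isNzRing.Build A
  nct_mulA nct_mul1l nct_mul1r nct_mulDl nct_mulDr nct_1neq0.
HB.instance Definition _ := GRing.Lmodule_isLalgebra.Build R[i] A nct_mulZl.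
HB.instance Definition _ := GRing.Lalgebra_isAlgebra.Build R[i] A nct_mulZr.

Lemma W0 : W 0 = 1 :> A.
Proof. by []. Qed.

Lemma mulWW k l :
  W k * W l = expi (h * (sigma k l)%:~R) *: W (k + l) :> A.
Proof. exact: nct_mulWW. Qed.

(* The antilinear extension of W_m^* = W_{-m} *)
Definition star a : A := antilinext (fun m => W (- m)) a.

Lemma star_antilinear x a b : star (x *: a + b) = x^* *: star a + star b.
Proof. exact: antilinext_antilinear. Qed.

Lemma starW m : star (W m) = W (- m) :> A.
Proof. exact: antilinextW. Qed.

(* The linear extension of W_m |-> W_{Theta m} *)
Definition Phi (Theta : lattice n -> lattice n) : A -> A :=
  linext (fun m => W (Theta m)).

HB.instance Definition _ Theta := GRing.Linear.on (Phi Theta).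

Lemma PhiW Theta m : Phi Theta (W m) = W (Theta m) :> A.
Proof. exact: linextW. Qed.

Definition tau : A -> R[i] :=
  linext (fun m => (m == 0)%:R : (R[i])^o).

Lemma tau_scalar : scalar tau.
Proof. exact: linext_is_linear. Qed.

HB.instance Definition _ :=
  GRing.isLinear.Build R[i] A R[i] *%R tau tau_scalar.

Lemma tauW m : tau (W m : A) = (m == 0)%:R.
Proof. exact: linextW. Qed.

(* In the order of R[i], 0 <= z means that z is real and nonnegative. *)
Definition is_state (omega : {scalar A}) : Prop :=
  (forall a, 0 <= omega (star a * a)) /\ omega (W 0) = 1.

End NCTorusAlgebra.

Section Symplectic.
Context {n : nat} (sigma : {biscalar (lattice n)}).

Definition skew_symmetric : Prop := forall k l, sigma k l = - sigma l k.

Definition nondegenerate_form : Prop :=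
  forall m, (forall l, sigma m l = 0) -> m = 0.

(* Theta \in Sp(Z^n, sigma) *)
Definition in_Sp (Theta : lattice n -> lattice n) : Prop :=
  [/\ zmod_morphism Theta, bijective Theta
    & forall k l, sigma (Theta k) (Theta l) = sigma k l].

End Symplectic.

Definition Sp_invariant (R : realType) (n : nat) (h : R)
    (sigma : {biscalar (lattice n)})
    (omega : {scalar (nctorus h sigma)}) : Prop :=
  forall Theta, in_Sp sigma Theta -> omega \o Phi Theta =1 omega.

(* Main.v *)
Require Import Defs.
From mathcomp Require Import all_boot all_order all_algebra.
From mathcomp Require Import finmap monalg complex.
From mathcomp Require Import boolp classical_sets reals trigo.
From mathcomp Require Import ring lra zify.

Import Order.TTheory GRing.Theory Num.Theory.

Local Open Scope ring_scope.

(** Let omega be an invariant state, m <> 0 and k = sigma(m, l) <> 0. The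
    transvections along l, followed by those along m, show that all the points
    n(p, i) = m + 2^p k l + i 2^D k^2 m (p < D, i < N) lie in the orbit of m, so
    omega takes the same value z on each W_{n(p, i)}. By Cauchy-Schwarz
    (D N z)^2 <= omega(A A^* ) with A the sum of the W_{n(p, i)}. In the double
    sum omega(A A^* ), the block of indices (p, q) is, up to a constant phase, a
    sum over i, j < N of omega(W_{v + (i - j) u}) times the j-th power of a
    phase: for p <> q that phase is not 1 because h / 2 pi is irrational, and
    the block is O(N); for p = q it is at most N^2. Letting N go to infinity
    gives D z^2 <= 1, for every D. *)

(** * Phases on the unit circle and geometric sums along a diagonal *)

Section Phase.
Context {R : realType}.

Lemma expi_2pi_int (k : int) : expi (2 * pi * k%:~R) = 1 :> R[i].
Proof.
have nat_case (j : nat) : expi (2 * pi * j%:R) = 1 :> R[i].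
  elim: j => [|j IHj]; first by rewrite mulr0 expi0.
  rewrite -[j.+1%:R]natr1 mulrDr expiD IHj mul1r mulr1 /expi.
  by rewrite mulr_natl cos2pi -[pi *+ 2]add0r sinD2pi sin0.
case: k => j; first exact: nat_case.
rewrite NegzE mulrNz mulrN -conjc_expi nat_case.
exact: conjc1.
Qed.

(** Subtracting a multiple of 2 pi gives [y] in [0, 2 pi[ with cosine 1. Injectivity of [cos] on
    [0, pi] settles [y], after the reflection to 2 pi - [y] when [y] exceeds pi. *)
Lemma expi_eq1 (t : R) : expi t = 1 -> exists k : int, t = 2 * pi * k%:~R.
Proof.
move=> et; have pi0 : 0 < (pi : R) := pi_gt0 R.
pose k := Num.floor (t / (2 * pi)); exists k.
have /andP[k1 k2] := floor_itv (t / (2 * pi)); rewrite -/k in k1 k2.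
have p20 : 0 < 2 * (pi : R) by lra.
rewrite ler_pdivlMr // in k1; rewrite ltr_pdivrMr // intrD in k2.
pose y := t - 2 * pi * k%:~R.
have y0 : 0 <= y by rewrite /y; lra.
have y2 : y < 2 * pi by rewrite /y; lra.
have cy : cos y = 1.
  have: expi y = 1 :> R[i].
    by rewrite /y expiD et mul1r -mulrN -mulrNz expi_2pi_int.
  by case.
suff: y = 0 by rewrite /y; lra.
have [yp|yp] := leP y pi.
  by apply: cos_inj; rewrite ?cy ?cos0 // in_itv /= ?y0 ?yp ?lexx ?ltW.
suff: 2 * pi - y = 0 by lra.
apply: cos_inj; rewrite ?in_itv /= ?lexx /=; try by (apply/andP; split; lra).
  exact: ltW.
rewrite cos0 -[RHS]cy -[RHS]cosN -[RHS]cosD2pi; congr cos.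
by rewrite mulr_natl addrC.
Qed.

Lemma expi_irrational (h : R) (k : int) :
  irrational (h / (2 * pi)) -> k != 0 -> expi (h * k%:~R) != 1.
Proof.
move=> hirr k0; apply/eqP => /expi_eq1[l hl]; apply: hirr.
have pi0 : 0 < (pi : R) := pi_gt0 R.
have k0' : k%:~R != 0 :> R by rewrite intr_eq0.
exists (l%:~R / k%:~R) => //; rewrite fmorph_div /= !ratr_int.
apply/eqP; rewrite eqr_div //; last by rewrite mulf_neq0 ?pnatr_eq0 ?gt_eqF.
by rewrite hl mulrC.
Qed.

Lemma normc_expi (t : R) : `|expi t| = 1.
Proof. by rewrite normc_def /= cos2Dsin2 sqrtr1. Qed.

End Phase.

(* Moving the square [0, N[^2 along its diagonal multiplies the sum by x but
   changes only O(N) of its terms. *)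
Lemma diagonal_geometric_sum (C : numDomainType) (x : C) (N : nat)
    (G : nat -> nat -> C) :
  (forall i j, `|G i j| <= 1) -> (forall i j, G i.+1 j.+1 = x * G i j) ->
  `|1 - x| * `|\sum_(i < N) \sum_(j < N) G i j| <= (4 * N + 2)%:R.
Proof.
move=> G1 Gx; set S := \sum_(i < N) _.
have bound (f : 'I_N -> C) : (forall i, `|f i| <= 1) ->
    `|\sum_(i < N) f i| <= N%:R.
  move=> f1; apply: (le_trans (ler_norm_sum _ _ _)).
  apply: (le_trans (ler_sum _ (fun i _ => f1 i))).
  by rewrite sumr_const card_ord.
(* The square of side N + 1 is cut in two ways: [E1] removes the last row and column, [E2] the first
   ones, which leaves the shifted square x S. *)
have E1 : \sum_(i < N.+1) \sum_(j < N.+1) G i j =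
    S + (\sum_(i < N) G i N + (\sum_(j < N) G N j + G N N)).
  rewrite big_ord_recr /= [X in _ + X]big_ord_recr /= !addrA; congr (_ + _ + _).
  by under eq_bigr do rewrite big_ord_recr /=; rewrite big_split.
have E2 : \sum_(i < N.+1) \sum_(j < N.+1) G i j =
    G 0 0 + \sum_(j < N) G 0 j.+1 + (\sum_(i < N) G i.+1 0 + x * S).
  rewrite big_ord_recl /= big_ord_recl /=; congr (_ + _).
  under eq_bigr do rewrite big_ord_recl /=.
  rewrite big_split /=; congr (_ + _); rewrite mulr_sumr.
  apply: eq_bigr => i _; rewrite mulr_sumr.
  by apply: eq_bigr => j _; rewrite -Gx.
have ES := canRL (addrK _) (etrans (esym E1) E2).
have -> : `|1 - x| * `|S| =
    `|G 0 0 + \sum_(j < N) G 0 j.+1 + \sum_(i < N) G i.+1 0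
      - (\sum_(i < N) G i N + (\sum_(j < N) G N j + G N N))|.
  rewrite -normrM; congr `| _ |; rewrite mulrBl mul1r {1}ES.
  by ring.
apply: (le_trans (ler_normB _ _)).
have norm3 a b c (u v w : C) :
    `|u| <= a -> `|v| <= b -> `|w| <= c -> `|u + v + w| <= a + b + c.
  by move=> *; do 2!(apply: (le_trans (ler_normD _ _)); rewrite lerD //).
(* Each of the two borders has 2 N + 1 terms. *)
have -> : (4 * N + 2)%:R = (1 + N%:R + N%:R) + (N%:R + N%:R + 1) :> C.
  by rewrite natrD natrM; ring.
apply: lerD; rewrite ?addrA; apply: norm3; try exact: G1.
all: by apply: bound => i; apply: G1.
Qed.

(** * The involution on sums and multiples *)

Section Star.
Context {R : realType} {n : nat} {h : R} {sigma : {biscalar (lattice n)}}.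
Local Notation A := (nctorus h sigma).
Implicit Types (a b : A).

Lemma starD a b : star (a + b) = star a + star b.
Proof. by have := star_antilinear 1 a b; rewrite rmorph1 !scale1r. Qed.

Lemma star0 : star 0 = 0 :> A.
Proof. by apply: (addIr (star (0 : A))); rewrite -starD !add0r. Qed.

Lemma starZ (x : R[i]) a : star (x *: a) = (x^*)%C *: star a.
Proof. by have := star_antilinear x a 0; rewrite star0 !addr0. Qed.

Lemma star_sum (I : Type) (r : seq I) (F : I -> A) :
  star (\sum_(i <- r) F i) = \sum_(i <- r) star (F i).
Proof. exact: (big_morph _ starD star0). Qed.

End Star.

(** * Symplectic automorphisms: -1 and the transvections *)

Section Symplectic.
Context {n : nat} (sigma : {biscalar (lattice n)}).
Hypothesis hskew : skew_symmetric sigma.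

Lemma skew_diag m : sigma m m = 0.
Proof. by have := hskew m m; lia. Qed.

Lemma in_Sp_opp : in_Sp sigma -%R.
Proof.
split; first by move=> x y; rewrite opprB opprK addrC.
  by exists -%R => x; rewrite opprK.
by move=> k l; rewrite linearNl linearNr opprK.
Qed.

Definition transvection (v : lattice n) (c : int) (m : lattice n) : lattice n :=
  m + (c * sigma m v) *: v.

Lemma sigmaZl (c : int) k l : sigma (c *: k) l = c * sigma k l.
Proof. exact: linearZl_LR. Qed.

Lemma sigmaZr (c : int) k l : sigma k (c *: l) = c * sigma k l.
Proof. exact: linearZr_LR. Qed.

Lemma transvectionK v c :
  cancel (transvection v c) (transvection v (- c)).
Proof.
move=> m; rewrite /transvection linearDl /= sigmaZl skew_diag mulr0 addr0.
by rewrite mulNr scaleNr addrK.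
Qed.

Lemma in_Sp_transvection v c : in_Sp sigma (transvection v c).
Proof.
split.
- move=> x y; rewrite /transvection linearBl /= mulrBr scalerBl.
  by rewrite opprD addrACA.
- exists (transvection v (- c)); first exact: transvectionK.
  by move=> m; rewrite -{1}[c]opprK transvectionK.
move=> k l; rewrite /transvection linearDl !linearDr /= !sigmaZl !sigmaZr.
by rewrite skew_diag (hskew v l); ring.
Qed.

End Symplectic.

(** * Values of an invariant state: reality, bound by 1, Cauchy-Schwarz *)

Section State.
Context {R : realType} {n : nat} {h : R} {sigma : {biscalar (lattice n)}}.
Context (omega : {scalar (nctorus h sigma)}).
Hypotheses (hstate : is_state omega) (hskew : skew_symmetric sigma).
Local Notation A := (nctorus h sigma).

Section Invariant.
Hypothesis hinv : Sp_invariant omega.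

Lemma Sp_invariantW Theta m : in_Sp sigma Theta ->
  omega (W (Theta m)) = omega (W m).
Proof. by move=> /hinv /(_ (W m)) /=; rewrite PhiW. Qed.

Lemma invariant_stateN m : omega (W (- m)) = omega (W m).
Proof. exact/(@Sp_invariantW -%R)/in_Sp_opp. Qed.

Lemma mulWNW m : W (- m) * W m = 1 :> A.
Proof.
by rewrite mulWW linearNl skew_diag // oppr0 mulr0 expi0 scale1r addNr W0.
Qed.

(** Positivity at 1 + x W_m; the two cross terms agree because -1 is symplectic. The cases x = 1 and
    x = -1 give reality and the bound by 1. *)
Lemma invariant_state_pos m (x : R[i]) : x ^+ 2 = 1 -> (x^*)%C = x ->
  0 <= 2 * (1 + x * omega (W m)).
Proof.
move=> x2 cx; have [pos om1] := hstate.
have := pos (1 + x *: W m).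
rewrite starD starZ cx -W0 !starW oppr0 W0 mulrDl !mulrDr !mul1r mulr1.
rewrite -scalerAl -scalerAr mulWNW !linearD !linearZ /= -W0 om1 invariant_stateN.
rewrite [x * (x * 1)]mulrA -expr2 x2; congr (_ <= _); ring.
Qed.

Lemma invariant_state_real m : omega (W m) \is Num.real.
Proof.
have := @invariant_state_pos m 1 (expr1n _ _) (rmorph1 _).
rewrite mul1r pmulr_rge0 ?ltr0n // => /ger0_real.
by rewrite -{2}[omega _](addKr 1) => ?; rewrite rpredD ?rpredN ?rpred1.
Qed.

Lemma invariant_state_le1 m : `|omega (W m)| <= 1.
Proof.
have r := invariant_state_real m.
rewrite real_ler_norml //; apply/andP; split.
  have := @invariant_state_pos m 1 (expr1n _ _) (rmorph1 _).
  by rewrite mul1r pmulr_rge0 ?ltr0n // -[- 1 <= _]subr_ge0 opprK addrC.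
have := @invariant_state_pos m (-1) (sqrr_sign _ 1) (rmorphN1 _).
by rewrite mulN1r pmulr_rge0 ?ltr0n // subr_ge0.
Qed.

(** Cauchy-Schwarz against the unit: with [c] = omega(B) real, positivity at B - c reads S - c^2 >=
    0. *)
Lemma invariant_state_gram (I : finType) (v : I -> lattice n) (z : R[i]) :
  (forall x, omega (W (v x)) = z) ->
  (#|I|%:R * z) ^+ 2 <= \sum_x \sum_y
    expi (h * (sigma (v x) (- v y))%:~R) * omega (W (v x - v y)).
Proof.
move=> vz; have [pos om1] := hstate.
(* For empty [I] nothing is known about [z]; otherwise it is a value of [omega], hence real. *)
case: (pickP I) => [x0 _|I0]; last first.
  by rewrite eq_card0 // mul0r expr0n big_pred0.
have cz : (z^*)%C = z by rewrite -(vz x0) -(RRe_real (invariant_state_real _)) conjc_real.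
set c := #|I|%:R * z; have cc : (c^*)%C = c by rewrite rmorphM rmorph_nat /= cz.
(* The minus signs make B^* B = B' B a sum of products W_{v x} W_{- v y}. *)
pose B : A := \sum_x W (- v x); pose B' : A := \sum_x W (v x).
have sB : star (B + (- c) *: 1) = B' + (- c) *: 1.
  rewrite starD starZ rmorphN /= cc -W0 starW oppr0 star_sum; congr (_ + _).
  by apply: eq_bigr => x _; rewrite starW opprK.
have oB : omega B = c.
  rewrite linear_sum /c mulr_natl -sumr_const; apply: eq_bigr => x _ /=.
  by rewrite invariant_stateN.
have oB' : omega B' = c.
  by rewrite linear_sum /c mulr_natl -sumr_const; apply: eq_bigr => x _ /=.
clearbody c.
have := pos (B + (- c) *: 1); rewrite sB mulrDl !mulrDr -!scalerAl -!scalerAr.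
rewrite mulr1 !mul1r scalerA !linearD !linearZ /= oB oB' -W0 om1.
set S := omega (B' * B) => S0.
have -> : \sum_x \sum_y expi (h * (sigma (v x) (- v y))%:~R) *
    omega (W (v x - v y)) = S.
  rewrite /S /B' mulr_suml linear_sum; apply: eq_bigr => x _.
  rewrite /B mulr_sumr linear_sum; apply: eq_bigr => y _.
  by rewrite mulWW linearZ.
rewrite -subr_ge0; apply: le_trans S0 _; rewrite le_eqVlt; apply/orP; left.
by apply/eqP; ring.
Qed.

End Invariant.
End State.

(** * Vanishing of an invariant state at W_m when sigma(m, l) is nonzero *)

Lemma archi_le0 (F : archiRealFieldType) (a b : F) :
  (forall N : nat, N%:R * a <= b) -> a <= 0.
Proof.
move=> ab; rewrite leNgt; apply/negP => a0.
have b0 : 0 <= b by have := ab 0%N; rewrite mul0r.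
have := archi_boundP (divr_ge0 b0 (ltW a0)); rewrite ltr_pdivrMr //.
by apply/negP; rewrite -leNgt.
Qed.

Section Vanishing.
Context {R : realType} {n : nat} {h : R} {sigma : {biscalar (lattice n)}}.
Context (omega : {scalar (nctorus h sigma)}).
Hypotheses (hirr : irrational (h / (2 * pi))) (hskew : skew_symmetric sigma).
Hypotheses (hstate : is_state omega) (hinv : Sp_invariant omega).
Variables m l : lattice n.
Let k := sigma m l.
Hypothesis k0 : k != 0.

(* The stride in [i] does not depend on [p], so that differences of such points
   only involve [i - j]. *)
Let orbit_pt (D p i : nat) : lattice n :=
  m + (2 ^+ p * k) *: l + (i%:R * (2 ^+ D * k ^+ 2)) *: m.

Let sigma_lm : sigma l m = - k.
Proof. exact: hskew. Qed.

Lemma omega_orbit_pt D p i : (p < D)%N ->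
  omega (W (orbit_pt D p i)) = omega (W m).
Proof.
(* The transvection along [l] sends m to m + 2^p k l, whose pairing with m is - 2^p k^2; this [c]
   turns it into the coefficient i 2^D k^2. *)
move=> pD; pose c : int := - (i%:R * 2 ^+ (D - p)).
have -> : orbit_pt D p i =
    transvection sigma m c (transvection sigma l (2 ^+ p) m).
  rewrite /orbit_pt /transvection -/k; congr (_ + _ *: _).
  rewrite linearDl /= sigmaZl skew_diag // sigma_lm add0r.
  by rewrite -{1}(subnK (ltnW pD)) exprD /c; ring.
by rewrite !(Sp_invariantW _ hinv) //; exact: in_Sp_transvection.
Qed.

(** The phase gained by a term of block (p, q) when i and j both increase by one. *)
Let ratio D p q : R[i] :=
  expi (h * (2 ^+ D * k ^+ 4 * (2 ^+ p - 2 ^+ q))%:~R).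

Let block_term D p q i j : R[i] :=
  expi (h * (sigma (orbit_pt D p i) (- orbit_pt D q j))%:~R)
    * omega (W (orbit_pt D p i - orbit_pt D q j)).

Lemma ratio_neq1 D p q : p != q -> ratio D p q != 1.
Proof.
move=> pq; apply: expi_irrational => //.
rewrite !mulf_neq0 ?expf_neq0 // subr_eq0.
by apply: contra pq => /eqP /(@ieexprIn _ 2) ->.
Qed.

Lemma block_term_le1 D p q i j : `|block_term D p q i j| <= 1.
Proof. by rewrite normrM normc_expi mul1r invariant_state_le1. Qed.

(** Both points move by the same multiple of m, so their difference is unchanged; only the phase
    varies, through the pairings of the points with m. *)
Lemma block_term_shift D p q i j :
  block_term D p q i.+1 j.+1 = ratio D p q * block_term D p q i j.
Proof.
have S r s : orbit_pt D r s.+1 = orbit_pt D r s + (2 ^+ D * k ^+ 2) *: m.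
  by rewrite /orbit_pt -[s.+1%:R]natr1 mulrDl mul1r scalerDl addrA.
have sm r s : sigma (orbit_pt D r s) m = - (2 ^+ r * k ^+ 2).
  rewrite /orbit_pt !linearDl /= !sigmaZl skew_diag // sigma_lm.
  by ring.
have ms r s : sigma m (orbit_pt D r s) = 2 ^+ r * k ^+ 2.
  by rewrite hskew sm opprK.
rewrite /block_term !S {2}opprD addrACA subrr addr0 mulrA -expiD -mulrDr -intrD.
congr (expi (h * _%:~R) * _).
move: (sm p i) (ms q j); move: (orbit_pt D p i) (orbit_pt D q j) => a b am mb.
rewrite !linearNr linearDl !linearDr /= !sigmaZl !sigmaZr am mb skew_diag //.
by ring.
Qed.

(** For p = q the ratio is 1 and the inverse of 0 is 0, so the right-hand side is just N^2. *)
Lemma block_bound D N p q :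
  `|\sum_(i < N) \sum_(j < N) block_term D p q i j| <=
    (p == q)%:R * (N ^ 2)%:R + (4 * N + 2)%:R / `|1 - ratio D p q|.
Proof.
have [<-|pq] := eqVneq p q; last first.
  rewrite mul0r add0r ler_pdivlMr ?normr_gt0; last first.
    by rewrite subr_eq0 eq_sym ratio_neq1.
  rewrite mulrC; apply: diagonal_geometric_sum; first exact: block_term_le1.
  exact: block_term_shift.
rewrite mul1r -[X in X <= _]addr0 lerD ?divr_ge0 //.
rewrite pair_bigA; apply: (le_trans (ler_norm_sum _ _ _)).
apply: (@le_trans _ _ (\sum_(x : 'I_N * 'I_N) 1)).
  by apply: ler_sum => x _; apply: block_term_le1.
by rewrite sumr_const card_prod card_ord -mulnn.
Qed.

Lemma gram_bound D N : ((D * N)%:R * omega (W m)) ^+ 2 <=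
  D%:R * (N ^ 2)%:R
    + (4 * N + 2)%:R * \sum_(p < D) \sum_(q < D) `|1 - ratio D p q|^-1.
Proof.
have := @invariant_state_gram _ _ _ _ omega hstate hskew hinv
  ('I_D * 'I_N)%type (fun x => orbit_pt D x.1 x.2) (omega (W m))
  (fun x => omega_orbit_pt D x.1 x.2 (ltn_ord x.1)).
rewrite card_prod !card_ord (_ : \sum_x _ = \sum_(p < D) \sum_(q < D)
    \sum_(i < N) \sum_(j < N) block_term D p q i j); last first.
  rewrite -(pair_bigA _ (fun (p : 'I_D) (i : 'I_N) =>
    \sum_(y : 'I_D * 'I_N) block_term D p y.1 i y.2)) /=.
  apply: eq_bigr => p _.
  under eq_bigr => i _ do rewrite -(pair_bigA _ (fun (q : 'I_D) (j : 'I_N) =>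
    block_term D p q i j)) /=.
  exact: exchange_big.
set S := \sum_(p < D) _ => sq_le; apply: (le_trans sq_le).
(* [S] dominates the square of a real number, so it may be replaced by its norm. *)
have S0 : 0 <= S.
  apply: le_trans sq_le; rewrite real_exprn_even_ge0 //.
  by rewrite rpredM ?realn ?invariant_state_real.
rewrite -(ger0_norm S0) mulr_sumr.
rewrite (_ : D%:R * _ = \sum_(p < D) (N ^ 2)%:R); last first.
  by rewrite sumr_const card_ord mulr_natl.
rewrite -big_split /=; apply: (le_trans (ler_norm_sum _ _ _)).
apply: ler_sum => p _; apply: (le_trans (ler_norm_sum _ _ _)).
apply: (@le_trans _ _ (\sum_(q < D) ((p == q)%:R * (N ^ 2)%:R
    + (4 * N + 2)%:R / `|1 - ratio D p q|))).
  by apply: ler_sum => q _; apply: block_bound.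
rewrite big_split /= mulr_sumr lerD // (bigD1 p) //= eqxx mul1r big1 ?addr0 //.
by move=> q qp; rewrite eq_sym (negPf qp) mul0r.
Qed.

Lemma invariant_state_vanish : omega (W m) = 0.
Proof.
rewrite -(RRe_real (invariant_state_real omega hstate hskew hinv m)).
set r := complex.Re _; suff: r ^+ 2 <= 0.
  by rewrite le_eqVlt ltNge sqr_ge0 orbF sqrf_eq0 => /eqP ->.
(* First limit: D r^2 <= 1 for every D. *)
apply: (@archi_le0 _ _ 1) => D.
suff: D%:R * (D%:R * r ^+ 2 - 1) <= 0.
  case: D => [|D]; first by rewrite !mul0r ler01.
  by rewrite pmulr_rle0 ?ltr0n // subr_le0.
pose K : R[i] := \sum_(p < D) \sum_(q < D) `|1 - ratio D p q|^-1.
have K0 : 0 <= K by do 2!(apply: sumr_ge0 => ? _); rewrite invr_ge0.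
set t := complex.Re K; have Kt : K = t%:C%C by rewrite /t RRe_real ?ger0_real.
have t0 : 0 <= t by rewrite -ler0c -Kt.
(* Second limit, in N with D fixed: [gram_bound] divided by N, where 4 N + 2 <= 6 N for N >= 1. *)
apply: (@archi_le0 _ _ (6 * t)) => N.
have := gram_bound D N; rewrite -/K Kt.
rewrite -(RRe_real (invariant_state_real omega hstate hskew hinv m)) -/r.
have RN j : j%:R = (j%:R : R)%:C%C by rewrite rmorph_nat.
rewrite !RN -!(rmorphM (real_complex R)) -(rmorphXn (real_complex R)).
rewrite -(rmorphD (real_complex R)) lecR.
case: N => [|N]; first by rewrite mul0r => _; rewrite mulr_ge0.
have N0 : 0 < N.+1%:R :> R by rewrite ltr0n.
rewrite (natrM _ D) natrD natrM natrX => E.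
have : 1 <= N.+1%:R :> R by rewrite ler1n.
move: E; set M := N.+1%:R; set d := D%:R => E M1.
have le6 : (4 * M + 2) * t <= M * (6 * t).
  by rewrite mulrA; apply: ler_wpM2r => //; lra.
rewrite -(ler_pM2l N0) [M * (M * _)](_ : _ = (d * M * r) ^+ 2 - d * M ^+ 2); last by ring.
by rewrite lerBlDl; apply: le_trans E _; rewrite lerD2l.
Qed.

End Vanishing.

(** * The trace is an invariant state *)

Section Trace.
Context {R : realType} {n : nat} {h : R} {sigma : {biscalar (lattice n)}}.
Hypothesis hskew : skew_symmetric sigma.
Local Notation A := (nctorus h sigma).

(** The trace kills W_{-m} W_k unless k = m. *)
Lemma tau_star_mul (a : A) :
  tau (star a * a) = \sum_(m <- supp a) `|coef m a| ^+ 2.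
Proof.
have star_span : star a = \sum_(m <- supp a) ((coef m a)^*)%C *: W (- m) by [].
rewrite star_span mulr_suml linear_sum /=.
apply: eq_big_seq => m ma; rewrite [X in _ * X]W_span mulr_sumr linear_sum /=.
rewrite (bigD1_seq m) ?supp_uniq //= big1 ?addr0 => [|k /negPf km].
  rewrite -scalerAl -scalerAr !linearZ /= mulWNW // -W0 tauW eqxx mulr1.
  by rewrite sqr_normc mulrC.
rewrite -scalerAl -scalerAr mulWW !linearZ /= tauW addrC subr_eq0 km.
by rewrite !mulr0.
Qed.

Lemma tau_state : is_state (tau : {scalar A}).
Proof.
split; last by rewrite /= tauW eqxx.
by move=> a; rewrite /= tau_star_mul; apply: sumr_ge0 => m _; rewrite exprn_ge0.
Qed.

Lemma tau_Sp_invariant : Sp_invariant (tau : {scalar A}).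
Proof.
move=> Theta [ThB /bij_inj ThI _] a /=.
elim/nct_ind: a => [|x a b IHa IHb|m]; first by rewrite !linear0.
  by rewrite !linearP /= IHa IHb.
have Th0 : Theta 0 = 0 by have := ThB 0 0; rewrite !subrr.
by rewrite PhiW !tauW -{1}Th0 (inj_eq ThI).
Qed.

End Trace.

Theorem mainTheorem1 (R : realType) (g : nat) (hg : (1 <= g)%N) (h : R)
    (hirr : irrational (h / (2 * pi)))
    (sigma : {biscalar (lattice (2 * g))})
    (hskew : skew_symmetric sigma) (hnondeg : nondegenerate_form sigma)
    (omega : {scalar (nctorus h sigma)}) :
  is_state omega /\ Sp_invariant omega <-> omega =1 tau.
Proof.
split=> [[hstate hinv] a|om_tau]; last first.
  have [tau_pos tau1] := tau_state (h := h) hskew.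
  split; first by split=> [a|]; rewrite om_tau; [exact: tau_pos | exact: tau1].
  by move=> Theta hTheta a /=; rewrite !om_tau; apply: tau_Sp_invariant.
elim/nct_ind: a => [|x a b IHa IHb|m]; first by rewrite !linear0.
  by rewrite !linearP /= IHa IHb.
rewrite tauW; have [->|m0] := eqVneq m 0; first by case: hstate.
(* Non-degeneracy provides the direction [l] of the transvections. *)
have [l k0] : exists l, sigma m l != 0.
  apply: contrapT => nol; case/eqP: m0; apply: hnondeg => l.
  by apply/eqP/negPn/negP => ?; apply: nol; exists l.
exact: invariant_state_vanish k0.
Qed.
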